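(* Let $(G,u)$ be a partially ordered abelian group with order unit, let $H$ be a subgroup of $G$, let $Z_G(H)=\{\tau\in S(G,u)\mid \tau(H)=\{0\}\}$, and let $F$ be the smallest face of $S(G,u)$ containing $Z_G(H)$. Let $\widehat H=\{\widehat h\mid h\in H\}$, where $\widehat h:S(G,u)\to\mathbb{R}$ is $\widehat h(\tau)=\tau(h)$. Suppose that the real vector space $\mathbb{R}\widehat H$ spanned by $\widehat H$ is finite-dimensional and that $\tau(H)$ is dense in $\mathbb{R}$ for each $\tau\in F\setminus Z_G(H)$. Then $H$ has property (B).
   Context: A partially ordered abelian group is an abelian group $G$ with a translation-invariant partial order; $G^+=\{x\ge 0\}$. An order unit is a nonzero $u\in G^+$ such that for each $g\in G$ there is a positive integer $N$ with $-Nu\le g\le Nu$. A trace on $G$ is a nonzero group homomorphism $\tau:G\to\mathbb{R}$ with $\tau(G^+)\subseteq[0,\infty)$; $S(G,u)$ is the set of traces with $\tau(u)=1$, a compact convex subset of $\mathbb{R}^G$ (product topology). A face of a convex set $K$ is a subset $F\subseteq K$ such that any line segment in $K$ whose relative interior meets $F$ is contained in $F$. For a subgroup $H$ and integer $m>1$, $H$ satisfies $(B_m)$ if for every $h\in H$ and every $\epsilon>0$ there exists $h'\in H$ with $\tau(h)-m\tau(h')\ge-\epsilon$ for all $\tau\in S(G,u)$; $H$ has property (B) if it satisfies $(B_m)$ for some integer $m>1$. *)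

(* Defs.v *)
From mathcomp Require Import all_boot all_order all_algebra.
From mathcomp Require Import all_classical all_reals all_analysis.

Set Implicit Arguments.
Unset Strict Implicit.
Unset Printing Implicit Defensive.

Import Order.TTheory GRing.Theory Num.Theory.
Import numFieldNormedType.Exports.

Local Open Scope classical_set_scope.
Local Open Scope ring_scope.

Section LinearAndConvex.
Context {R : realType} {V : lmodType R}.

Definition lin_span (A : set V) : set V :=
  [set v | exists n (c : 'I_n -> R) (a : 'I_n -> V),
             (forall i, A (a i)) /\ v = \sum_(i < n) c i *: a i].

Definition finite_dimensional (W : set V) : Prop :=
  exists n (e : 'I_n -> V), W = lin_span (range e).

Definition line_segment (x y : V) : set V :=
  [set (1 - t) *: x + t *: y | t in `[0 : R, 1]].

(* For x = y this is the singleton {x}, as the relative interior should be. *)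
Definition line_segment_relint (x y : V) : set V :=
  [set (1 - t) *: x + t *: y | t in `]0 : R, 1[].

Definition is_face (K F : set V) : Prop :=
  F `<=` K /\
  forall x y : V, line_segment x y `<=` K ->
    line_segment_relint x y `&` F !=set0 -> line_segment x y `<=` F.

End LinearAndConvex.

(* porderZmodType carries a partial order and an abelian group structure with
   no compatibility between them; this is the missing axiom. *)
Definition translation_invariant (G : porderZmodType) : Prop :=
  forall x y z : G, x <= y -> x + z <= y + z.

Definition order_unit (G : porderZmodType) (u : G) : Prop :=
  [/\ u != 0, 0 <= u &
      forall g : G, exists2 N : nat, (0 < N)%N & - (u *+ N) <= g <= u *+ N].

Section Traces.
Context {R : realType} {G : porderZmodType}.

Definition is_trace (tau : G -> R) : Prop :=
  [/\ zmod_morphism tau, tau <> 0 & forall x : G, 0 <= x -> 0 <= tau x].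

(* The codomain is R^o so that functions into it form a real vector space. *)
Definition trace_space (u : G) : set (G -> R^o) :=
  [set tau | is_trace tau /\ tau u = 1].

Definition annihilator (u : G) (H : zmodClosed G) : set (G -> R^o) :=
  [set tau | trace_space u tau /\ tau @` [set` H] = [set 0]].

Definition smallest_face (u : G) (Z : set (G -> R^o)) : set (G -> R^o) :=
  smallest (is_face (trace_space u)) Z.

Definition hat (u : G) (h : G) : trace_space u -> R^o :=
  fun tau => \val tau h.

Definition hat_subgroup (u : G) (H : zmodClosed G) :
    set (trace_space u -> R^o) :=
  [set hat h | h in [set` H]].

End Traces.

Definition property_Bm (R : realType) (G : porderZmodType) (u : G)
    (H : zmodClosed G) (m : nat) : Prop :=
  forall h : G, h \in H -> forall eps : R, 0 < eps ->
    exists2 h' : G, h' \in H &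
      forall tau : G -> R, trace_space u tau ->
        - eps <= tau h - m%:R * tau h'.

Definition property_B (R : realType) (G : porderZmodType) (u : G)
    (H : zmodClosed G) : Prop :=
  exists2 m : nat, (1 < m)%N & property_Bm R u H m.

(* Main.v *)
Require Import Defs.
From mathcomp Require Import all_boot all_order all_algebra.
From mathcomp Require Import all_classical all_reals all_analysis.
From mathcomp Require Import ring lra.

Set Implicit Arguments.
Unset Strict Implicit.
Unset Printing Implicit Defensive.

Import Order.TTheory GRing.Theory Num.Theory.
Import numFieldNormedType.Exports.

Local Open Scope classical_set_scope.
Local Open Scope ring_scope.

(* Let h_1, ..., h_n in H span the functions on S(G,u) given by H, let
   p(tau) = (tau(h_1), ..., tau(h_n)), and let K = p(S(G,u)), a compact convex
   subset of R^n.  The elements of H act on K as an additive subgroup A of R^n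
   containing the standard basis.  Let W be the span of the smallest face of K
   containing 0.  The hypothesis says that every nonzero vector of W takes dense
   values on A, which forces A to be dense modulo the orthogonal of W.

   A functional f vanishing on W admits, for every eps > 0, some c with
   c >= max(0, f) - eps on K: the convex hull of K x {0} and of the graph of f
   over K is compact and misses (0, eps), because 0 is only a convex combination
   of points of K lying in W; a separating hyperplane gives c.

   Given h and eps, an element h' of A close to (h - c) / 2 modulo the orthogonal
   of W leaves h - 2 h' equal to c, plus a bounded combination of finitely many
   functionals vanishing on W, plus a small error.  A suitable c makes this at
   least - eps on K, so H satisfies (B_2). *)

(** * Separation in finite dimension *)

Section RowNorm.
Context {R : realType} {n : nat}.
Implicit Types (v : 'rV[R]_n) (e : R).

Lemma row_norm_le v i : `|v 0 i| <= `|v|.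
Proof.
rewrite [`|v|]mx_normrE.
exact: (le_bigmax _ (fun ij => `|v ij.1 ij.2|) (0, i)).
Qed.

Lemma row_norm_lt v e : 0 < e -> (forall i, `|v 0 i| < e) -> `|v| < e.
Proof.
move=> e0 ve; rewrite [`|v|]mx_normrE; apply: bigmax_lt => //= -[i j] _ /=.
by rewrite ord1.
Qed.

End RowNorm.

Section Dot.
Context {R : realType} {n : nat}.
Implicit Types (a : R) (c v w : 'rV[R]_n).

Definition dot c v : R := (c *m v^T) 0 0.

Lemma dotE c v : dot c v = \sum_i c 0 i * v 0 i.
Proof. by rewrite /dot mxE; apply: eq_bigr => i _; rewrite mxE. Qed.

Lemma dotC c v : dot c v = dot v c.
Proof. by rewrite !dotE; apply: eq_bigr => i _; rewrite mulrC. Qed.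

Lemma dotDl c v w : dot (c + v) w = dot c w + dot v w.
Proof. by rewrite /dot mulmxDl mxE. Qed.

Lemma dotZl a c v : dot (a *: c) v = a * dot c v.
Proof. by rewrite /dot -scalemxAl mxE. Qed.

Lemma dotDr c v w : dot c (v + w) = dot c v + dot c w.
Proof. by rewrite ![dot c _]dotC dotDl. Qed.

Lemma dotZr a c v : dot c (a *: v) = a * dot c v.
Proof. by rewrite ![dot c _]dotC dotZl. Qed.

Lemma dotNl c v : dot (- c) v = - dot c v.
Proof. by rewrite -scaleN1r dotZl mulN1r. Qed.

Lemma dotBl c v w : dot (c - v) w = dot c w - dot v w.
Proof. by rewrite dotDl dotNl. Qed.

Lemma dotBr c v w : dot c (v - w) = dot c v - dot c w.
Proof. by rewrite ![dot c _]dotC dotBl. Qed.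

Lemma dot0l v : dot 0 v = 0.
Proof. by rewrite -(scale0r 0) dotZl mul0r. Qed.

Lemma dot0r v : dot v 0 = 0.
Proof. by rewrite dotC dot0l. Qed.

Lemma dot_sqrD a v w :
  dot (v + a *: w) (v + a *: w) =
  dot v v + 2 * a * dot v w + a ^+ 2 * dot w w.
Proof. by rewrite !(dotDl, dotDr, dotZl, dotZr) (dotC w v); ring. Qed.

Lemma dot_suml I (r : seq I) (P : pred I) (F : I -> 'rV[R]_n) v :
  dot (\sum_(i <- r | P i) F i) v = \sum_(i <- r | P i) dot (F i) v.
Proof.
by elim/big_rec2: _ => [|i x y _ <-]; rewrite ?dot0l ?dotDl.
Qed.

Lemma dot_delta i v : dot (delta_mx 0 i) v = v 0 i.
Proof.
rewrite dotE (bigD1 i)//= mxE !eqxx mul1r big1 ?addr0// => j ji.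
by rewrite mxE eqxx (negPf ji) mul0r.
Qed.

Lemma dot_gt0 v : v != 0 -> 0 < dot v v.
Proof.
move=> v0; have [i vi] : exists i, v 0 i != 0.
  apply/existsP; apply: contraNT v0 => /existsPn v0.
  by apply/eqP/rowP => i; rewrite mxE; apply/eqP/negPn/v0.
rewrite dotE (bigD1 i)//= ltr_wpDr//; last first.
  by rewrite lt_def mulf_neq0//= -expr2 sqr_ge0.
by apply: sumr_ge0 => j _; rewrite -expr2 sqr_ge0.
Qed.

Lemma dot_ge0 v : 0 <= dot v v.
Proof. by have [->|/dot_gt0/ltW//] := eqVneq v 0; rewrite dot0l. Qed.

Lemma dot_le c v : `|dot c v| <= `|c| * \sum_i `|v 0 i|.
Proof.
rewrite dotE mulr_sumr (le_trans (ler_norm_sum _ _ _))//.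
by apply: ler_sum => i _; rewrite normrM ler_wpM2r// row_norm_le.
Qed.

End Dot.

Lemma continuous_sum (R : realType) (T : topologicalType) n
    (F : 'I_n -> T -> R) :
  (forall i, continuous (F i)) -> continuous (fun x => \sum_(i < n) F i x).
Proof.
elim: n F => [|n IH] F cF x.
  by under eq_fun do rewrite big_ord0; exact: cvg_cst.
under eq_fun do rewrite big_ord_recl.
apply: cvgD; first exact: cF.
by apply: IH => i; exact: cF.
Qed.

(** Convexity is asked of the image only, so [T] can be any topological space, without vector
    operations. *)
Definition convex_image (R : realType) (T : Type) (C : set T) n
    (p : T -> 'rV[R]_n) :=
  forall x y t, C x -> C y -> 0 <= t <= 1 ->
    exists2 z, C z & p z = (1 - t) *: p x + t *: p y.

(** A point of the image with least Euclidean norm serves as normal vector: its minimality makes the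
    first variation toward any other image point nonnegative. *)
Lemma separate_zero (R : realType) (T : topologicalType) (C : set T) n
    (g : T -> 'rV[R]_n) :
  compact C -> (forall i, continuous (fun x => g x 0 i)) ->
  convex_image C g ->
  (forall x, C x -> g x != 0) ->
  exists c k, 0 < k /\ forall x, C x -> k <= dot c (g x).
Proof.
move=> Cc gc gcvx g0.
have [->|/set0P C0] := eqVneq C set0.
  by exists 0, 1; split.
have [] := @compact_EVT_min T R (fun x => dot (g x) (g x)) C C0 Cc.
  apply: continuous_subspaceT => x.
  under eq_fun do rewrite dotE.
  apply: continuous_sum => i y; apply: cvgM; exact: gc.
move=> x0; rewrite inE => Cx0 xmin.
exists (g x0), (dot (g x0) (g x0)); split; first exact/dot_gt0/g0.
move=> x Cx; rewrite -subr_ge0.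
have -> : dot (g x0) (g x) - dot (g x0) (g x0) = dot (g x0) (g x - g x0).
  by rewrite dotBr.
set w := g x - g x0; set p := dot _ w; have q0 := dot_ge0 w.
rewrite leNgt; apply/negP => p0.
set q := dot w w in q0.
have qp : 0 < q - p by rewrite subr_gt0 (lt_le_trans p0).
(* If [p < 0], this [t] satisfies [t * q = t * p - p], so moving by [t] toward [g x] changes the
   squared norm by [t * (p + t * p) < 0]. *)
pose t := - p / (q - p).
have t0 : 0 < t by rewrite divr_gt0// oppr_gt0.
have t1 : t <= 1 by rewrite ler_pdivrMr// mul1r; lra.
have [|z Cz gz] := gcvx x0 x t Cx0 Cx; first by rewrite (ltW t0).
have := xmin z (mem_set Cz); rewrite gz.
have -> : (1 - t) *: g x0 + t *: g x = g x0 + t *: w.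
  by rewrite /w scalerBr scalerBl scale1r -addrA [- _ + _]addrC.
rewrite dot_sqrD -/p -/q => H.
have : 0 <= t * (2 * p + t * q) by lra.
rewrite pmulr_rge0//; apply/negP; rewrite -ltNge.
have e : t * (q - p) = - p by rewrite divfK// gt_eqF.
have : p * t <= 0 by rewrite nmulr_rle0// ltW.
lra.
Qed.

Lemma dot_row_mx (R : realType) m n (a u : 'rV[R]_m) (b v : 'rV[R]_n) :
  dot (row_mx a b) (row_mx u v) = dot a u + dot b v.
Proof. by rewrite /dot tr_row_mx mul_row_col mxE. Qed.

Lemma convex_image_weights (R : realType) (T : Type) (C : set T) n
    (p : T -> 'rV[R]_n) a b x y :
  convex_image C p -> C x -> C y -> 0 <= a -> 0 <= b ->
  exists2 z, C z & (a + b) *: p z = a *: p x + b *: p y.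
Proof.
move=> cvx Cx Cy a0 b0; have [ab|ab] := eqVneq (a + b) 0.
  have [-> ->] : a = 0 /\ b = 0 by lra.
  by exists x; rewrite // addr0 !scale0r addr0.
have {}ab : 0 < a + b by rewrite lt_def ab addr_ge0.
have [|z Cz pz] := cvx x y (b / (a + b)) Cx Cy.
  by rewrite divr_ge0 ?(ltW ab)//= ler_pdivrMr// mul1r lerDr.
exists z => //; rewrite pz scalerDr !scalerA mulrBr mulr1 mulrC divfK ?gt_eqF//.
by rewrite addrK.
Qed.

Lemma majorant (R : realType) (T : topologicalType) (C : set T) n
    (p : T -> 'rV[R]_n) (B : R) (f : 'rV[R]_n) (eps : R) :
  compact C -> (forall i, continuous (fun x => p x 0 i)) ->
  convex_image C p ->
  (forall x, C x -> \sum_i `|p x 0 i| <= B) ->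
  (forall x y s t, C x -> C y -> 0 < s -> 0 < t ->
    s *: p x + t *: p y = 0 -> dot f (p x) = 0) ->
  0 < eps ->
  exists c, forall x, C x ->
    - eps <= dot c (p x) /\ dot f (p x) - eps <= dot c (p x).
Proof.
move=> Cc pc cvx pB f0 eps0.
(* A triple [(x1, x2, l)] parametrizes the convex hull of the graph of [f] (weight [l]) and of the
   zero section (weight [1 - l]), translated so that [(0, eps)] becomes the origin. *)
pose D : set (T * T * R) := (C `*` C) `*` `[0, 1].
pose g (z : T * T * R) : 'rV[R]_(n + 1) :=
  row_mx (z.2 *: p z.1.1 + (1 - z.2) *: p z.1.2)
         (const_mx (z.2 * dot f (p z.1.1) - eps)).
have D_compact : compact D.
  by apply: compact_setX; [exact: compact_setX|exact: segment_compact].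
have [|||c [k [k0 ck]]] := @separate_zero R _ D _ g D_compact.
- have fstc : continuous (fun z : T * T * R => z.1.1).
    by move=> z; apply: (@continuous_comp _ _ _ fst fst); exact: cvg_fst.
  have sndc : continuous (fun z : T * T * R => z.1.2).
    move=> z; apply: (@continuous_comp _ _ _ fst snd).
      exact: cvg_fst.
    exact: cvg_snd.
  have p1c i : continuous (fun z : T * T * R => p z.1.1 0 i).
    by move=> z; exact: (@continuous_comp _ _ _ _ (fun x => p x 0 i) _ (fstc z) (pc i _)).
  have p2c i : continuous (fun z : T * T * R => p z.1.2 0 i).
    by move=> z; exact: (@continuous_comp _ _ _ _ (fun x => p x 0 i) _ (sndc z) (pc i _)).
  move=> i z.
  case: (splitP i) => j ij.
    have -> : i = lshift 1 j by apply: val_inj.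
    under eq_fun do rewrite row_mxEl !mxE.
    apply: cvgD; apply: cvgM; [exact: cvg_snd|exact: p1c| |exact: p2c].
    by apply: cvgB; [exact: cvg_cst|exact: cvg_snd].
  have -> : i = rshift n j by apply: val_inj.
  under eq_fun do rewrite row_mxEr !mxE dotE.
  apply: cvgB; last exact: cvg_cst.
  apply: cvgM; first exact: cvg_snd.
  apply: continuous_sum => l y; apply: cvgM; first exact: cvg_cst.
  exact: p1c.
- move=> [[x1 x2] l] [[y1 y2] m] t [[/= Cx1 Cx2]]; rewrite in_itv/= => l01.
  move=> [[/= Cy1 Cy2]]; rewrite in_itv/= => m01 t01.
  have [||z1 Cz1 e1] := convex_image_weights (a := (1 - t) * l)
    (b := t * m) cvx Cx1 Cy1; [nra|nra|].
  have [||z2 Cz2 e2] := convex_image_weights (a := (1 - t) * (1 - l))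
    (b := t * (1 - m)) cvx Cx2 Cy2; [nra|nra|].
  (* First and second points are merged separately; [q] is the total weight of the first ones. *)
  pose q := (1 - t) * l + t * m.
  exists (z1, z2, q).
    by split; [split|rewrite /= in_itv/= /q; nra].
  have e1q : q *: p z1 = (1 - t) * l *: p x1 + t * m *: p y1 by [].
  have e2q : (1 - q) *: p z2 = (1 - t) * (1 - l) *: p x2 + t * (1 - m) *: p y2.
    by rewrite -e2; congr (_ *: _); rewrite /q; ring.
  rewrite /g /= !scale_row_mx add_row_mx; congr row_mx.
    by rewrite e1q e2q !scalerDr !scalerA addrACA.
  apply/matrixP => i j; rewrite !mxE.
  by rewrite -dotZr e1q dotDr !dotZr; ring.
(* At a zero of [g] the last coordinate gives [l * dot f (p x1) = eps], hence [l > 0] and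
   [dot f (p x1) != 0], against [f0]. *)
- move=> [[x1 x2] l] [[/= Cx1 Cx2]]; rewrite in_itv/= => /andP[l0 l1].
  rewrite row_mx_eq0; apply/negP => /andP[/eqP/= e1 /eqP/matrixP/(_ 0 0)].
  rewrite !mxE => /eqP; rewrite subr_eq0 => /eqP e2.
  have {}l0 : 0 < l.
    rewrite lt_def l0 andbT; apply/eqP => l_0.
    by move: e2; rewrite l_0 mul0r => e; rewrite -e ltxx in eps0.
  have : dot f (p x1) = 0.
    have [l_1|l_1] := eqVneq l 1.
      apply: (f0 x1 x1 1 1) => //.
      by move: e1; rewrite l_1 subrr scale0r addr0 scale1r => ->; rewrite addr0.
    apply: (f0 x1 x2 l (1 - l)) => //.
    by rewrite subr_gt0 lt_neqAle l_1.
  by move=> e; move: e2; rewrite e mulr0 => e2; rewrite -e2 ltxx in eps0.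
set a := lsubmx c; set s := rsubmx c 0 0.
have {}ck x1 x2 l : C x1 -> C x2 -> 0 <= l <= 1 ->
    k <= l * dot a (p x1) + (1 - l) * dot a (p x2)
         + s * (l * dot f (p x1) - eps).
  move=> Cx1 Cx2 l01; have /ck : D (x1, x2, l).
    by split; [split|rewrite /= in_itv].
  rewrite -{1}(hsubmxK c) dot_row_mx /g /= dotDr !dotZr.
  by rewrite [dot (rsubmx c) _]dotE big_ord1 [const_mx _ _ _]mxE.
(* If [s] is nonnegative, [l = 0] shows that [a] is at least [k > 0] on the image, so a large
   multiple of [a] dominates the bounded values of [f]. *)
have [s0|s0] := leP 0 s.
  exists ((`|f| * `|B| / k) *: a) => x Cx; rewrite dotZl.
  have kx : k <= dot a (p x).
    have := ck x x 0 Cx Cx; rewrite lexx ler01 => /(_ isT).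
    have : 0 <= s * eps by rewrite mulr_ge0 // ltW.
    lra.
  have fx : dot f (p x) <= `|f| * `|B|.
    apply: le_trans (ler_norm _) _; apply: le_trans (dot_le _ _) _.
    by rewrite ler_wpM2l// (le_trans (pB _ Cx))// ler_norm.
  have fB0 : 0 <= `|f| * `|B| by rewrite mulr_ge0.
  have : `|f| * `|B| <= `|f| * `|B| / k * dot a (p x).
    rewrite -mulrA ler_peMr// mulrC ler_pdivlMr// mul1r; exact: kx.
  lra.
(* If [s < 0], the separating hyperplane is a graph; after division by [- s], the cases [l = 0] and
   [l = 1] give the two bounds. *)
have s_gt0 : 0 < - s by rewrite oppr_gt0.
exists ((- s)^-1 *: a) => x Cx; rewrite dotZl.
rewrite -[(- s)^-1 * _]mulrC !ler_pdivlMr//.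
have := ck x x 0 Cx Cx; rewrite lexx ler01 => /(_ isT) h0.
have := ck x x 1 Cx Cx; rewrite lexx ler01 => /(_ isT) h1.
by split; lra.
Qed.

(** * Dense subgroups of R^n *)

Definition additive_subgroup (V : zmodType) (A : set V) :=
  A 0 /\ forall x y, A x -> A y -> A (x - y).

Lemma subgroupD (V : zmodType) (A : set V) x y :
  additive_subgroup A -> A x -> A y -> A (x + y).
Proof.
move=> [A0 AB] Ax Ay; rewrite -[y]opprK; apply: (AB) => //.
by rewrite -sub0r; exact: AB.
Qed.

Lemma subgroupMz (V : zmodType) (A : set V) x (z : int) :
  additive_subgroup A -> A x -> A (x *~ z).
Proof.
move=> Ag Ax; have An n : A (x *+ n).
  by elim: n => [|n IH]; [exact: Ag.1|rewrite mulrS; exact: subgroupD].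
case: z => n; first exact: An.
by rewrite NegzE mulrNz -sub0r; apply: Ag.2; [exact: Ag.1|exact: An].
Qed.

Lemma subgroup_sum (V : zmodType) (A : set V) n (F : 'I_n -> V) :
  additive_subgroup A -> (forall i, A (F i)) -> A (\sum_i F i).
Proof.
move=> Ag AF; elim/big_rec: _ => [|i x _ Ax]; first exact: Ag.1.
exact: subgroupD.
Qed.

Definition dot_dense (R : realType) n (A : set 'rV[R]_n) (x : 'rV[R]_n) :=
  forall r e, 0 < e -> exists2 a, A a & `|r - dot a x| < e.

Definition dense_rows (R : realType) n (A : set 'rV[R]_n) :=
  forall t e, 0 < e -> exists2 a, A a & `|t - a| < e.

Section DenseSubgroup.
Context {R : realType}.

(** Functionals on the quotient by the line of [v] pull back to functionals vanishing at [v], so the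
    image of [A] in the quotient inherits dense values and the induction hypothesis applies. *)
Lemma dense_modulo_line k (A : set 'rV[R]_k.+1) (v : 'rV[R]_k.+1) :
  (forall B : set 'rV[R]_k, additive_subgroup B ->
     (forall x, x != 0 -> dot_dense B x) -> dense_rows B) ->
  additive_subgroup A -> (forall x, x != 0 -> dot_dense A x) -> v != 0 ->
  forall t e, 0 < e -> exists a s, A a /\ `|t - a - s *: v| < e.
Proof.
move=> IH Ag Ad v0 t e e0.
have [i vi] : exists i, v 0 i != 0.
  apply/existsP; apply: contraNT v0 => /existsPn v0.
  by apply/eqP/rowP => i; rewrite mxE; apply/eqP/negPn/v0.
(* Projection along [v] onto the coordinates other than [i]. *)
pose pr (x : 'rV[R]_k.+1) : 'rV[R]_k :=
  \row_j (x 0 (lift i j) - x 0 i / v 0 i * v 0 (lift i j)).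
have prB x y : pr (x - y) = pr x - pr y.
  by apply/rowP => j; rewrite !mxE; field.
have prAg : additive_subgroup (pr @` A).
  split; first by exists 0; [exact: Ag.1|apply/rowP => j; rewrite !mxE !mul0r subr0].
  by move=> _ _ [a Aa <-] [b Ab <-]; exists (a - b); [exact: Ag.2|exact: prB].
have prAd y : y != 0 -> dot_dense (pr @` A) y.
  move=> y0 r d d0.
  (* The [i]-th entry makes [z] orthogonal to [v]. *)
  pose z : 'rV[R]_k.+1 := \row_l
    if unlift i l is Some j then y 0 j
    else - \sum_j v 0 (lift i j) / v 0 i * y 0 j.
  have zE x : dot x z = dot (pr x) y.
    rewrite !dotE (bigD1_ord i)//= mxE unlift_none mulrN mulr_sumr.
    rewrite addrC -sumrB; apply: eq_bigr => j _.
    by rewrite !mxE liftK; ring.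
  have [|a Aa ra] := Ad z _ r d d0; last first.
    by exists (pr a); [exists a|rewrite -zE].
  apply: contraNneq y0 => z0; apply/eqP/rowP => j.
  by move/rowP/(_ (lift i j)): z0; rewrite !mxE liftK.
have [_ [a Aa <-] ta] := IH _ prAg prAd (pr t) e e0.
(* This multiple of [v] makes the [i]-th coordinate of the error vanish. *)
exists a, ((t - a) 0 i / v 0 i); split => //.
apply: row_norm_lt => // j; rewrite ![in X in `|X|]mxE.
case: (unliftP i j) => [l ->|->].
  apply: le_lt_trans ta; rewrite -prB.
  by have := row_norm_le (pr (t - a)) l; rewrite !mxE.
by rewrite divfK// addrC addNr normr0.
Qed.

Lemma small_elements1 (A : set 'rV[R]_1) :
  (forall x, x != 0 -> dot_dense A x) ->
  forall e, 0 < e -> exists a, [/\ A a, a != 0 & `|a| < e].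
Proof.
move=> Ad e e0.
have d0 : delta_mx 0 0 != 0 :> 'rV[R]_1.
  by apply/eqP => /matrixP/(_ 0 0)/eqP; rewrite !mxE eqxx oner_eq0.
(* A value within [e / 2] of [e / 2] lies strictly between [0] and [e]. *)
have [|a Aa] := Ad _ d0 (e / 2) (e / 2); first by rewrite divr_gt0.
rewrite dotC dot_delta ltr_norml => /andP[a1 a2].
exists a; split => //.
  by apply/eqP => a0; move: a1 a2; rewrite a0 mxE; lra.
by apply: row_norm_lt => // i; rewrite ord1 ltr_norml; apply/andP; split; lra.
Qed.

(* Modulo [a] the subgroup is dense, so it comes close to many small multiples
   of a direction [delta j] transverse to [a], up to fractions of [a]; two of
   these fractions nearly agree by the pigeonhole principle. *)
Lemma small_elements2 k (A : set 'rV[R]_k) a (i j : 'I_k) :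
  additive_subgroup A -> A a -> a 0 i != 0 -> i != j ->
  (forall t e, 0 < e -> exists b s, A b /\ `|t - b - s *: a| < e) ->
  forall e, 0 < e -> exists b, [/\ A b, b != 0 & `|b| < e].
Proof.
move=> Ag Aa ai ij Ad e e0.
pose c := a 0 j / a 0 i.
(* Three scales: a bin of width [1 / M] costs less than [e / 4] along [a]; [M] steps of length [rho]
   add up to [e / 4]; [eta] is too small to cancel one step or to exceed the remaining budget. *)
pose M := (Num.truncn (4 * `|a| / e)).+1.
have M0 : 0 < M%:R :> R by rewrite ltr0n.
have aM : `|a| / M%:R < e / 4.
  rewrite ltr_pdivrMr// -ltr_pdivrMl ?divr_gt0//.
  have := truncnS_gt (4 * `|a| / e); rewrite -/M invf_div.
  by rewrite mulrAC.
pose rho := e / (4 * M%:R).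
have rho0 : 0 < rho by rewrite divr_gt0// mulr_gt0.
pose eta := Num.min (rho / (4 * (1 + `|c|))) (e / 8).
have eta0 : 0 < eta.
  by rewrite lt_min !divr_gt0// mulr_gt0// ltr_pwDl.
have /choice[b /all_and2[Ab bE]] (m : nat) : exists b, A b /\
    exists2 s, 0 <= s < 1 &
      `|(m%:R * rho) *: delta_mx 0 j - b - s *: a| < eta.
  have [b [s [Ab bs]]] := Ad ((m%:R * rho) *: delta_mx 0 j) eta eta0.
  (* Integer multiples of [a] stay in [A] and reduce the coefficient of [a] to its fractional
     part. *)
  exists (b + a *~ Num.floor s); split.
    by apply: subgroupD => //; exact: subgroupMz.
  exists (s - (Num.floor s)%:~R).
    by have /andP[] := floor_itv s; rewrite intrD subr_ge0 ltrBlDl => -> ->.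
  rewrite -scaler_int scalerBl opprD opprB !addrA.
  by rewrite subrK.
have /choice[s /all_and2[s01 bs]] (m : nat) : exists s, 0 <= s < 1 /\
    `|(m%:R * rho) *: delta_mx 0 j - b m - s *: a| < eta.
  by have [s s01 bs] := bE m; exists s.
have bin_lt m : (Num.truncn (M%:R * s m) < M)%N.
  have /andP[s0 s1] := s01 m.
  by rewrite truncn_lt_nat ?mulr_ge0// gtr_pMr.
pose bin (m : 'I_M.+1) : 'I_M := Ordinal (bin_lt m).
have /injectivePn [m [m' mm' /(congr1 val)/= bb]] : ~~ injectiveb bin.
  by apply/injectiveP => /leq_card; rewrite !card_ord ltnn.
pose d := b m - b m'.
pose err (m : nat) := (m%:R * rho) *: delta_mx 0 j - b m - s m *: a.
have dE : d = ((m%:R - m'%:R) * rho) *: delta_mx 0 j - (s m - s m') *: a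
              - (err m - err m').
  apply/rowP => l; rewrite /d /err !mxE; ring.
have errlt l : `|(err m - err m') 0 l| < 2 * eta.
  apply: le_lt_trans (row_norm_le _ _) _.
  apply: le_lt_trans (ler_normB _ _) _.
  by rewrite mulr2n mulrDl mul1r ltrD// /err bs.
exists d; split; first exact: Ag.2.
  apply/eqP => d0.
  (* The functional [x 0 j - c * x 0 i] kills [a], so on [d] it is a nonzero integer multiple of
     [rho] up to an error below [rho / 2]. *)
  have : d 0 j - c * d 0 i = 0 by rewrite d0 !mxE mulr0 subrr.
  have -> : d 0 j - c * d 0 i = (m%:R - m'%:R) * rho
     - ((err m - err m') 0 j - c * (err m - err m') 0 i).
    rewrite dE; move: (err m - err m') => w; rewrite !mxE !eqxx (negPf ij) /= mulr1 mulr0.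
    by rewrite /c; field.
  move/eqP; rewrite subr_eq0 => /eqP E.
  have : rho <= `|(m%:R - m'%:R) * rho|.
    rewrite normrM (gtr0_norm rho0) ler_pMl//.
    have: m%:Z - m'%:Z != 0 by rewrite subr_eq0; apply: contra mm' => /eqP[/val_inj->].
    by rewrite -(@normr_gt0 int) gtz0_ge1 -(ler_int R) intr_norm intrB.
  rewrite E; apply/negP; rewrite -ltNge.
  apply: le_lt_trans (ler_normB _ _) _; rewrite normrM.
  have h1 := errlt j; have h2 := errlt i.
  have h3 : eta * (4 * (1 + `|c|)) <= rho.
    by rewrite -ler_pdivlMr ?mulr_gt0 ?ltr_pwDl// ge_min lexx.
  have h4 : `|c| * `|(err m - err m') 0 i| <= `|c| * (2 * eta).
    by rewrite ler_wpM2l// ltW.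
  have h5 : 0 <= `|c| * eta by rewrite mulr_ge0// ltW.
  lra.
apply: row_norm_lt => // l.
have h1 := errlt l.
have h2 : eta <= e / 8 by rewrite ge_min lexx orbT.
have h3 : `|(m%:R - m'%:R) * rho| <= e / 4.
  have -> : rho = e / 4 / M%:R by rewrite /rho invfM mulrA.
  rewrite normrM [X in _ * X]gtr0_norm ?divr_gt0 ?divr_gt0// mulrC.
  rewrite -[e / 4 / _ * _]mulrA ler_piMr//.
    by rewrite divr_ge0// ltW.
  rewrite mulrC ler_pdivrMr// mul1r ler_norml; apply/andP; split.
    have : m'%:R <= M%:R :> R by rewrite ler_nat -ltnS.
    have : 0 <= m%:R :> R by []. 
    lra.
  have : m%:R <= M%:R :> R by rewrite ler_nat -ltnS.
  have : 0 <= m'%:R :> R by [].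
  lra.
have h4 : `|s m - s m'| <= M%:R^-1.
  have /andP[s0 s1] := s01 m; have /andP[s0' s1'] := s01 m'.
  have /andP[] := truncn_itv (mulr_ge0 (ltW M0) s0).
  have /andP[] := truncn_itv (mulr_ge0 (ltW M0) s0').
  rewrite bb -natr1 => u1 u2 u3 u4.
  rewrite -[M%:R^-1]mul1r ler_pdivlMr//.
  have : `|(s m - s m') * M%:R| <= 1.
    by rewrite ler_norml; apply/andP; split; lra.
  by rewrite normrM (gtr0_norm M0).
have h5 : `|(s m - s m') * a 0 l| <= `|a| / M%:R.
  rewrite normrM mulrC ler_pM// row_norm_le//.
have -> : d 0 l = (m%:R - m'%:R) * rho * (l == j)%:R - (s m - s m') * a 0 l
     - (err m - err m') 0 l.
  by rewrite dE; move: (err m - err m') => w; rewrite !mxE eqxx.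
apply: le_lt_trans (ler_normB _ _) _.
have := ler_normB ((m%:R - m'%:R) * rho * (l == j)%:R) ((s m - s m') * a 0 l).
have : `|(m%:R - m'%:R) * rho * (l == j)%:R| <= `|(m%:R - m'%:R) * rho|.
  by rewrite normrM ler_piMr// normr_nat lern1; case: eqP.
lra.
Qed.

(** Directions of ever shorter elements accumulate at some [v], and integer multiples of a very
    short element come close to every real multiple of its direction. *)
Lemma line_in_closure k (A : set 'rV[R]_k) :
  additive_subgroup A ->
  (forall e, 0 < e -> exists a, [/\ A a, a != 0 & `|a| < e]) ->
  exists2 v, v != 0 & forall s e, 0 < e -> exists2 a, A a & `|s *: v - a| < e.
Proof.
move=> Ag As.
have /choice[u uP] (m : nat) : exists a, [/\ A a, a != 0 & `|a| < m.+1%:R^-1].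
  by apply: As; rewrite invr_gt0.
pose w m := `|u m|^-1 *: u m.
have u0 m : 0 < `|u m| by rewrite normr_gt0; case: (uP m).
have w1 m : `|w m| = 1.
  by rewrite /w normrZ gtr0_norm ?invr_gt0// mulVf// gt_eqF.
pose K : set 'rV[R]_k := [set v | forall i, (fun=> `[-1, 1]%classic) i (v 0 i)].
have Kc : compact K by apply: rV_compact => i; exact: segment_compact.
have [|v [_ vcl]] := Kc (w @ \oo).
  exists 0%N => // m _ i /=.
  by rewrite in_itv/= -ler_norml -(w1 m) row_norm_le.
have vw N e : 0 < e -> exists2 m, (N <= m)%N & `|v - w m| < e.
  move=> e0; have [_ [[m Nm <-]]] : [set w m | m in [set m | (N <= m)%N]]
      `&` ball v e !=set0.
    apply: vcl; last exact: nbhsx_ballx.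
    by exists N => // m Nm; exists m.
  by rewrite -ball_normE /= => ?; exists m.
exists v.
  have [m _ vm] := vw 0%N 1 ltr01; apply/eqP => v0.
  by move: vm; rewrite v0 sub0r normrN w1 ltxx.
move=> s e e0.
(* Half of [e] pays for both errors: [s] times the distance from [v] to [w m], and the rounding to
   an integer multiple of [u m]. *)
pose d := e / (2 * (1 + `|s|)).
have s1 : 0 < 1 + `|s| by rewrite ltr_pwDl.
have d0 : 0 < d by rewrite divr_gt0// mulr_gt0.
pose N := Num.truncn d^-1.
have [m Nm vm] := vw N d d0.
have um : `|u m| < d.
  case: (uP m) => _ _ /lt_le_trans; apply.
  rewrite -[d]invrK lef_pV2 ?posrE ?invr_gt0//.
  apply: le_trans (ltW (truncnS_gt _)) _.
  by rewrite ler_nat.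
pose z := Num.floor (s / `|u m|).
exists (u m *~ z); first by apply: subgroupMz => //; case: (uP m).
have -> : s *: v - u m *~ z = s *: (v - w m) + (s / `|u m| - z%:~R) *: u m.
  by rewrite scalerBr scalerBl -/w scaler_int /w scalerA addrA subrK.
apply: le_lt_trans (ler_normD _ _) _; rewrite !normrZ.
have : `|s / `|u m| - z%:~R| <= 1.
  have /andP[z1 z2] := floor_itv (s / `|u m|).
  by move: z2; rewrite intrD ler_norml => z2; apply/andP; split; lra.
have h1 : `|s| * `|v - w m| <= `|s| * d by rewrite ler_wpM2l// ltW.
move=> /(ler_wpM2r (ltW (u0 m))); rewrite mul1r => h2.
have h3 : d * (1 + `|s|) = e / 2 by rewrite /d; field; rewrite gt_eqF.
lra.
Qed.

(** Induction on the dimension: the closure of [A] contains a line, and [A] is dense modulo that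
    line. *)
Lemma dense_subgroup k (A : set 'rV[R]_k) :
  additive_subgroup A -> (forall x, x != 0 -> dot_dense A x) -> dense_rows A.
Proof.
elim: k A => [|k IH] A Ag Ad t e e0.
  exists 0; first exact: Ag.1.
  by apply: row_norm_lt => // -[].
have As : forall e, 0 < e -> exists a, [/\ A a, a != 0 & `|a| < e].
  (* In dimension one no direction is transverse to [a], so that case is separate. *)
  case: k IH A Ag Ad t => [|k] IH A Ag Ad _; first exact: small_elements1.
  have d0 : delta_mx 0 0 != 0 :> 'rV[R]_k.+2.
    by apply/eqP => /matrixP/(_ 0 0)/eqP; rewrite !mxE eqxx oner_eq0.
  have [a Aa] := Ad _ d0 1 1 ltr01; rewrite dotC dot_delta => a0.
  have {}a0 : a 0 0 != 0.
    by apply: contraTneq a0 => ->; rewrite subr0 normr1 ltxx.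
  apply: (@small_elements2 _ A a 0 (lift 0 0)) => //.
  apply: dense_modulo_line => //.
  by apply: contraNneq a0 => ->; rewrite mxE.
have [v v0 vA] := line_in_closure Ag As.
have e2 : 0 < e / 2 by rewrite divr_gt0.
have [a [s [Aa ta]]] := dense_modulo_line IH Ag Ad v0 t e2.
have [b Ab sb] := vA s _ e2.
exists (a + b); first exact: subgroupD.
have -> : t - (a + b) = (t - a - s *: v) + (s *: v - b).
  by rewrite opprD !addrA subrK.
by rewrite (le_lt_trans (ler_normD _ _))//; lra.
Qed.

End DenseSubgroup.

(** * The statement for compact convex sets *)

(** A matrix with rows in [W] and of maximal rank has row space [W]; some column of its cokernel
    then detects [x]. *)
Lemma orthogonal_separation (R : realType) n (W : set 'rV[R]_n) x :
  W 0 -> (forall v w, W v -> W w -> W (v + w)) ->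
  (forall a v, W v -> W (a *: v)) -> ~ W x ->
  exists l, (forall w, W w -> dot l w = 0) /\ dot l x != 0.
Proof.
move=> W0 WD WZ Wx.
pose P r := `[< exists m (M : 'M[R]_(m, n)),
  (forall i, W (row i M)) /\ \rank M = r >].
have P0 : exists r, P r.
  exists 0%N; apply/asboolP; exists 0%N, 0; split; first by case.
  by rewrite mxrank0.
have Pn r : P r -> (r <= n)%N.
  by move=> /asboolP[m [M [_ <-]]]; exact: rank_leq_col.
have [r /asboolP[m [M [WM rM]]] maxr] := ex_maxnP P0 Pn.
have subM w : W w -> (w <= M)%MS.
  move=> Ww; apply/negPn/negP => wM.
  have : (M < col_mx M w)%MS.
    have : (col_mx M w <= col_mx M w)%MS by [].
    by rewrite ltmxE !col_mx_sub (negPf wM) andbF => /andP[->].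
  rewrite ltmxErank => /andP[_]; rewrite rM; apply/negP; rewrite -leqNgt.
  apply: maxr; apply/asboolP; exists (m + 1)%N, (col_mx M w); split => // i.
  case: (splitP i) => j ij.
    have -> : i = lshift 1 j by apply: val_inj.
    suff -> : row (lshift 1 j) (col_mx M w) = row j M by [].
    by apply/rowP => k; rewrite mxE col_mxEu mxE.
  have -> : i = rshift m j by apply: val_inj.
  suff -> : row (rshift m j) (col_mx M w) = w by [].
  by apply/rowP => k; rewrite mxE col_mxEd ord1.
have : ~~ (x <= M)%MS.
  apply/negP => /submxP[D xD]; apply: Wx; rewrite xD mulmx_sum_row.
  elim/big_rec: _ => // i v _ Wv; apply: WD => //; exact: WZ.
rewrite submxE => xM.
have [j xj] : exists j, (x *m cokermx M) 0 j != 0.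
  apply/existsP; apply: contraNT xM => /existsPn xM0; apply/eqP/rowP => j.
  by rewrite [RHS]mxE; apply/eqP/negPn/xM0.
have dotE w : dot (col j (cokermx M))^T w = (w *m cokermx M) 0 j.
  by rewrite dotE mxE; apply: eq_bigr => i _; rewrite !mxE mulrC.
exists (col j (cokermx M))^T; split; last by rewrite dotE.
move=> w /subM; rewrite submxE => /eqP wM.
by rewrite dotE wM mxE.
Qed.

Section ReducedStatement.
Context {R : realType} {T : topologicalType} {n : nat}.
Variables (C : set T) (p : T -> 'rV[R]_n) (B : R) (A : set 'rV[R]_n).
Hypothesis C_compact : compact C.
Hypothesis p_continuous : forall i, continuous (fun x => p x 0 i).
Hypothesis p_convex : convex_image C p.
Hypothesis p_bounded : forall x, C x -> \sum_i `|p x 0 i| <= B.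
Hypothesis A_subgroup : additive_subgroup A.
Hypothesis A_delta : forall i, A (delta_mx 0 i).
(** The relation puts [0] strictly between [p x] and [p y], hence [p x] in the smallest face
    containing [0]; density is asked at the nonzero points of that face. *)
Hypothesis A_dense : forall x y s t, C x -> C y -> 0 < s -> 0 < t ->
  s *: p x + t *: p y = 0 -> p x != 0 -> dot_dense A (p x).

(* The linear span of the smallest face of [p @` C] containing [0], or [0] when
   there is no such face. *)
Let W : set 'rV[R]_n := [set v | v = 0 \/ exists x y s t,
  [/\ C x, C y, 0 < s & 0 < t] /\ v = s *: p x /\ - v = t *: p y].

Let Wperp : set 'rV[R]_n := [set l | forall w, W w -> dot l w = 0].

Let WD v w : W v -> W w -> W (v + w).
Proof.
move=> [->|Wv]; first by rewrite add0r.
move=> [->|Ww]; first by rewrite addr0; right.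
move: Wv Ww => [x [y [s [t [[Cx Cy s0 t0] [-> yE]]]]]].
move=> [x' [y' [s' [t' [[Cx' Cy' s'0 t'0] [-> y'E]]]]]].
have [z Cz zE] := convex_image_weights p_convex Cx Cx' (ltW s0) (ltW s'0).
have [z' Cz' z'E] := convex_image_weights p_convex Cy Cy' (ltW t0) (ltW t'0).
right; exists z, z', (s + s'), (t + t'); split; first by split; rewrite ?addr_gt0.
by rewrite zE z'E opprD yE y'E.
Qed.

Let WZ a v : W v -> W (a *: v).
Proof.
move=> [->|]; first by left; rewrite scaler0.
move=> [x [y [s [t [[Cx Cy s0 t0] [xE yE]]]]]].
have [a0|a0|->] := ltgtP a 0; last by left; rewrite scale0r.
  (* A negative scalar exchanges the two opposite points. *)
  right; exists y, x, (- a * t), (- a * s).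
  split; first by split; rewrite // mulr_gt0 ?oppr_gt0.
  by rewrite -!scalerA -xE -yE scalerN scaleNr opprK.
right; exists x, y, (a * s), (a * t); split; first by split; rewrite // mulr_gt0.
by rewrite -!scalerA -xE -yE scalerN.
Qed.

(** The subgroup [A + Wperp] is dense: a functional given by a nonzero vector of [W] already has
    dense values on [A], and any vector outside [W] pairs nontrivially with a line inside
    [Wperp]. *)
Lemma dense_modulo_perp t e : 0 < e ->
  exists a l, [/\ A a, Wperp l & `|t - a - l| < e].
Proof.
move=> e0; pose D := [set b | exists a l, [/\ A a, Wperp l & b = a + l]].
have perp0 : Wperp 0 by move=> w _; rewrite dot0l.
have [||_ [a [l [Aa Wl ->]]]] := @dense_subgroup R n D _ _ t e e0.
- split; first by exists 0, 0; split; rewrite ?addr0//; exact: A_subgroup.1.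
  move=> _ _ [a [l [Aa Wl ->]]] [a' [l' [Aa' Wl' ->]]].
  exists (a - a'), (l - l'); split; first exact: A_subgroup.2.
    by move=> w Ww; rewrite dotBl Wl// Wl'// subrr.
  by rewrite opprD addrACA.
- move=> x x0 r d d0; have [Wx|Wx] := pselect (W x).
    case: Wx => [xE|]; first by rewrite xE eqxx in x0.
    move=> [y [z [s [u [[Cy Cz s0 u0] [xE zE]]]]]].
    have py0 : p y != 0 by apply: contraNneq x0 => py; rewrite xE py scaler0.
    have [||a Aa ra] := A_dense Cy Cz s0 u0 _ py0 (r / s) (e := d / s).
    + by rewrite -xE -zE subrr.
    + by rewrite divr_gt0.
    exists a; first by exists a, 0; rewrite addr0.
    have -> : r - dot a x = s * (r / s - dot a (p y)).
      by rewrite xE dotZr; field; rewrite gt_eqF.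
    by rewrite normrM (gtr0_norm s0) mulrC -ltr_pdivlMr.
  have [l [Wl lx]] := orthogonal_separation (or_introl erefl) WD WZ Wx.
  exists (r / dot l x *: l); last by rewrite dotZl divfK// subrr normr0.
  exists 0, (r / dot l x *: l); split; last by rewrite add0r.
    exact: A_subgroup.1.
  by move=> w Ww; rewrite dotZl (Wl w)// mulr0.
by rewrite opprD addrA => h; exists a, l.
Qed.

(* With [t = (a0 - c) / 2] rounded to [a] in [A], the value [a0 - 2 a] is
   [c + 2 (t - a)], and [t - a] is, up to a small error, a combination of the
   finitely many [l i] in [Wperp] with coefficients in [0, q].  Functionals in
   [Wperp] can be compensated by [c] at an arbitrarily small cost. *)
Lemma halving a0 eps : 0 < eps ->
  exists2 a, A a & forall x, C x -> - eps <= dot (a0 - 2 *: a) (p x).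
Proof.
move=> eps0.
pose B1 := `|B| + 1.
have B10 : 0 < B1 by rewrite ltr_pwDr.
have pB1 x : C x -> \sum_i `|p x 0 i| <= B1.
  move=> /p_bounded /le_trans; apply; rewrite (le_trans (ler_norm _))//.
  by rewrite lerDl.
(* Each of the [n] coordinates will cost at most [3 * mu]; [n.+1] avoids a zero denominator. *)
pose mu := eps / (3 * n.+1%:R).
have mu0 : 0 < mu by rewrite divr_gt0// mulr_gt0.
pose q := (Num.truncn (2 * B1 / mu)).+1.
have q0 : 0 < q%:R :> R by rewrite ltr0n.
have qmu : 2 * B1 / q%:R <= mu.
  rewrite ler_pdivrMr// -ler_pdivrMl// [mu^-1 * _]mulrC.
  by rewrite ltW// truncnS_gt.
(* Up to [q] copies of an approximation error, doubled, then cost at most [mu]. *)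
pose d := mu / (2 * q%:R * B1).
have qB0 : 0 < 2 * q%:R * B1 by rewrite !mulr_gt0.
have d0 : 0 < d by rewrite divr_gt0.
have /choice[a /choice[l alP]] (i : 'I_n) : exists a l,
    [/\ A a, Wperp l & `|q%:R^-1 *: delta_mx 0 i - a - l| < d].
  exact: dense_modulo_perp.
(* The factor [2 * q] covers all the multiples [2 * m i] of [l i], since [m i <= q]. *)
have /choice[c cP] (i : 'I_n) : exists c, forall x, C x ->
    - mu <= dot c (p x) /\ dot (- (2 * q%:R) *: l i) (p x) - mu <= dot c (p x).
  apply: (majorant C_compact p_continuous p_convex p_bounded) => //.
  move=> x y s t Cx Cy s0 t0 xy; rewrite dotZl.
  have [_ Wl _] := alP i.
  have : dot (l i) (s *: p x) = 0.
    apply: Wl; right; exists x, y, s, t; split => //; split => //.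
    by apply/eqP; rewrite eq_sym -addr_eq0 addrC xy.
  rewrite dotZr => /eqP; rewrite mulf_eq0 gt_eqF//= => /eqP ->.
  by rewrite mulr0.
pose t := 2^-1 *: (a0 - \sum_i c i).
pose z i := Num.floor (t 0 i).
pose m i := Num.truncn (q%:R * (t 0 i - (z i)%:~R)).
have frac i : 0 <= t 0 i - (z i)%:~R < 1.
  have /andP[] := floor_itv (t 0 i); rewrite intrD -/(z i) => h1 h2.
  by apply/andP; split; lra.
have mP i : (m i)%:R <= q%:R * (t 0 i - (z i)%:~R) < (m i)%:R + 1.
  have /andP[h _] := frac i.
  by have := truncn_itv (mulr_ge0 (ltW q0) h); rewrite -natr1.
have mq i : (m i)%:R <= q%:R :> R.
  have /andP[h1 h2] := frac i; have /andP[h3 _] := mP i.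
  by apply: le_trans h3 _; rewrite ler_piMr// ltW.
(* Integer parts of [t] are matched by basis vectors, which lie in [A]; fractional parts are rounded
   down to multiples of [1 / q], with [a i] standing for [1 / q] of a basis vector. *)
pose a' := \sum_i (delta_mx 0 i *~ z i + a i *~ m i).
exists a'.
  apply: subgroup_sum => // i; apply: subgroupD => //; apply: subgroupMz => //.
  by have [] := alP i.
move=> x Cx.
have [err errE] : exists err, forall i,
    err i = q%:R^-1 *: delta_mx 0 i - a i - l i by eexists => i.
have tE : t - a' = \sum_i
    ((t 0 i - (z i)%:~R - (m i)%:R / q%:R) *: delta_mx 0 i
     + (m i)%:R *: (l i + err i)).
  rewrite [in LHS](row_sum_delta t) /a' -sumrB; apply: eq_bigr => i _.
  rewrite errE [l i + _]addrC subrK.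
  rewrite -[delta_mx 0 i *~ _]scaler_int -[a i *~ _]scaler_int -pmulrn.
  by rewrite opprD scalerBr !scalerBl scalerA !addrA subrK.
have -> : a0 - 2 *: a' = \sum_i c i + 2 *: (t - a').
  rewrite scalerBr /t scalerA divff ?pnatr_eq0// scale1r.
  by rewrite addrA [_ + (a0 - _)]addrC subrK.
rewrite tE scaler_sumr -big_split/= dot_suml.
have errB i : `|dot (err i) (p x)| <= d * B1.
  apply: le_trans (dot_le _ _) _; apply: ler_pM => //; last exact: pB1.
    by apply: sumr_ge0.
  by rewrite errE; have [_ _ /ltW] := alP i.
have piB i : `|p x 0 i| <= B1.
  apply: le_trans (pB1 _ Cx); rewrite (bigD1 i)//= lerDl.
  by apply: sumr_ge0.
have dB : 2 * q%:R * (d * B1) = mu.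
  by rewrite /d; field; rewrite !gt_eqF.
have term i : - (3 * mu) <=
    dot (c i + 2 *: ((t 0 i - (z i)%:~R - (m i)%:R / q%:R) *: delta_mx 0 i
                     + (m i)%:R *: (l i + err i))) (p x).
  rewrite !(dotDl, dotZl) dot_delta.
  have [h1 h2] := cP i x Cx; rewrite dotZl in h2.
  have m0 : 0 <= (m i)%:R :> R by [].
  have h3 : - mu <= dot (c i) (p x) + 2 * ((m i)%:R * dot (l i) (p x)).
    (* A nonnegative value of [l i] only helps the first bound on [c i]; a negative one is worst at
       [m i = q], which is the second bound. *)
    have [L|L] := leP 0 (dot (l i) (p x)).
      by have := mulr_ge0 m0 L; lra.
    have := mq i; rewrite -subr_ge0 => /mulr_ge0_le0/(_ (ltW L)).
    lra.
  have h4 : `|(m i)%:R * dot (err i) (p x)| <= q%:R * (d * B1).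
    by rewrite normrM ler_pM// ger0_norm.
  have h5 : `|(t 0 i - (z i)%:~R - (m i)%:R / q%:R) * p x 0 i| <= B1 / q%:R.
    rewrite normrM mulrC ler_pM//.
    have /andP[h5 h6] := mP i.
    have -> : t 0 i - (z i)%:~R - (m i)%:R / q%:R
      = (q%:R * (t 0 i - (z i)%:~R) - (m i)%:R) / q%:R.
      by field; rewrite gt_eqF.
    rewrite normrM [`|_^-1|]gtr0_norm ?invr_gt0// ler_piMl ?invr_ge0//.
    by rewrite ler_norml; apply/andP; split; lra.
  move: h3 h4 h5 dB qmu; rewrite !ler_norml
     -[2 * _ * (d * B1)]mulrA -[2 * B1 / _]mulrA [_ * (_ + dot _ _)]mulrDr.
  move: (_ * p x 0 i) (_ * dot (l i) _) (_ * dot (err i) _) (q%:R * _) (B1 / _).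
  move=> X1 X2 X3 X4 X5 h3 /andP[h4 _] /andP[h5 _] ? ?.
  lra.
apply: le_trans (ler_sum _ (fun i _ => term i)).
rewrite sumr_const card_ord mulNrn lerN2.
have -> : eps = 3 * mu *+ n.+1.
  by rewrite -mulr_natr /mu; field; rewrite nat1r pnatr_eq0.
by rewrite ler_wpMn2l// mulr_ge0// ltW.
Qed.

End ReducedStatement.

(** * Traces *)

Section FiniteSpan.
Context {R : realType} {V : lmodType R}.

Definition combinations n (b : 'I_n -> V) : set V :=
  [set v | exists c : 'rV[R]_n, v = \sum_i c 0 i *: b i].

Lemma combinations_mem n (b : 'I_n -> V) i : combinations b (b i).
Proof.
exists (delta_mx 0 i); rewrite (bigD1 i)//= mxE !eqxx scale1r big1 ?addr0//.
by move=> j ji; rewrite mxE (negPf ji) scale0r.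
Qed.

Lemma combinations_sum n (b : 'I_n -> V) m (c : 'I_m -> R) (a : 'I_m -> V) :
  (forall j, combinations b (a j)) -> combinations b (\sum_j c j *: a j).
Proof.
move=> /choice[d dE]; exists (\sum_j c j *: d j).
under eq_bigr do rewrite dE scaler_sumr.
rewrite exchange_big/=; apply: eq_bigr => i _.
rewrite summxE scaler_suml; apply: eq_bigr => j _.
by rewrite mxE scalerA.
Qed.

(** Each of finitely many spanning vectors uses finitely many elements of [A]; listing all of these
    gives [b], possibly with linear dependences. *)
Lemma finite_dimensional_span (A : set V) :
  finite_dimensional (lin_span A) ->
  exists n (b : 'I_n -> V), (forall i, A (b i)) /\ A `<=` combinations b.
Proof.
move=> [n [e AE]].
have mem_span (B : set V) v : B v -> lin_span B v.
  move=> Bv; exists 1%N, (fun=> 1), (fun=> v); split => //.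
  by rewrite big_ord1 scale1r.
have : forall i, lin_span A (e i).
  by move=> i; rewrite AE; apply: mem_span; exists i.
move=> Ae.
have [N [b [Ab be]]] : exists N (b : 'I_N -> V),
    (forall i, A (b i)) /\ forall i, combinations b (e i).
  elim: n e {AE} Ae => [|n IH] e Ae.
    by exists 0%N, (fun=> 0); split; case.
  have [N [b [Ab be]]] := IH (fun i => e (lift ord0 i)) (fun i => Ae _).
  have [m [c [a [Aa eE]]]] := Ae ord0.
  pose b' (k : 'I_(N + m)) := match fintype.split k with inl i => b i | inr j => a j end.
  have b'l i : b' (lshift m i) = b i by rewrite /b' (unsplitK (inl i)).
  have b'r j : b' (rshift N j) = a j by rewrite /b' (unsplitK (inr j)).
  exists (N + m)%N, b'; split.
    by move=> k; rewrite /b'; case: (fintype.split k).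
  move=> i; case: (unliftP ord0 i) => [j ->|->].
    have [d ->] := be j; apply: combinations_sum => l.
    by rewrite -b'l; exact: combinations_mem.
  rewrite eE; apply: combinations_sum => l.
  by rewrite -b'r; exact: combinations_mem.
exists N, b; split => // v Av.
have : lin_span (range e) v by rewrite -AE; exact: mem_span.
move=> [m [c [a [ea ->]]]]; apply: combinations_sum => j.
by have [i _ <-] := ea j.
Qed.

End FiniteSpan.

(** * Compactness, convexity and faces of the trace space *)

Section TraceSpace.
Context {R : realType} {G : porderZmodType}.
Variable u : G.
Hypothesis G_ordered : translation_invariant G.
Hypothesis u_unit : order_unit u.

Lemma trace_zmod (tau : G -> R^o) :
  trace_space u tau -> zmod_morphism (tau : G -> R).
Proof. by move=> [[]]. Qed.

Lemma zmod_morphism0 (f : G -> R) : zmod_morphism f -> f 0 = 0.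
Proof. by move=> fB; rewrite -(subr0 0) fB subrr. Qed.

Lemma zmod_morphismMn (f : G -> R) g n : zmod_morphism f -> f (g *+ n) = f g *+ n.
Proof.
move=> fB; elim: n => [|n IH]; first by rewrite !mulr0n zmod_morphism0.
have fD x y : f (x + y) = f x + f y.
  by rewrite -[y in LHS]opprK -[- y]sub0r !fB zmod_morphism0// sub0r opprK.
by rewrite !mulrS fD IH.
Qed.

(** Traces are monotone and send [u] to [1], so the order-unit bound on [g] limits all of them at
    once. *)
Lemma trace_bounded : exists N : G -> nat, forall tau : G -> R^o,
  trace_space u tau -> forall g, `|tau g| <= (N g)%:R.
Proof.
have [_ _ /(_ _)/cid2-/all_sig2[N _ uN]] := u_unit.
exists N => tau [[tauB _ tau0] tau1] g.
have mono x y : x <= y -> tau x <= tau y.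
  move=> xy; have := G_ordered (- x) xy; rewrite subrr => /tau0.
  by rewrite tauB subr_ge0.
have /andP[/mono + /mono] := uN g.
rewrite -sub0r tauB zmod_morphism0// sub0r zmod_morphismMn// tau1.
by rewrite ler_norml => -> ->.
Qed.

Lemma trace_space_compact :
  compact (trace_space u : set (prod_topology (fun _ : G => R))).
Proof.
have [N NP] := trace_bounded.
pose K : set (prod_topology (fun _ : G => R)) :=
  [set f | forall g, `[- (N g)%:R, (N g)%:R]%classic (f g)].
have Kc : compact K.
  exact: (@tychonoff G (fun=> R) _ (fun g => @segment_compact R _ _)).
apply: (subclosed_compact _ Kc); last first.
  by move=> tau /NP tauN g; rewrite /= in_itv/= -ler_norml.
have evc g : continuous (fun f : prod_topology (fun _ : G => R) => f g).
  exact: proj_continuous.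
(* Equations and weak inequalities between evaluations define a closed set; [tau u = 1] yields
   [tau <> 0]. *)
have -> : trace_space u = [set tau : prod_topology (fun _ : G => R) |
    (tau u = 1 /\ forall xy : G * G, tau (xy.1 - xy.2) - tau xy.1 + tau xy.2 = 0)
    /\ forall x, 0 <= x -> 0 <= tau x].
  rewrite eqEsubset; split => tau /=.
    move=> [[tauB _ tau0] tau1]; split; last exact: tau0.
    by split => // -[x y] /=; rewrite tauB; lra.
  move=> [[tau1 tauB] tau0]; split => //; split => //.
    by move=> x y; have /= := tauB (x, y); lra.
  by move=> tau_0; move/eqP: tau1; rewrite tau_0 eq_sym oner_eq0.
have closed_fiber (f : prod_topology (fun _ : G => R) -> R) r :
    continuous f -> closed [set tau | f tau = r].
  move=> fc; apply: (@preimage_closed _ _ f [set r]); last exact: closed_eq.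
  by move=> x _; exact: fc.
apply: closedI; first apply: closedI.
- exact: closed_fiber.
- rewrite [X in closed X](_ : _ = \bigcap_(xy : G * G)
     [set tau : prod_topology (fun _ : G => R) |
       tau (xy.1 - xy.2) - tau xy.1 + tau xy.2 = 0]).
    apply: closed_bigI => xy _; apply: closed_fiber => tau.
    exact: (cvgD (cvgB (evc (xy.1 - xy.2) tau) (evc xy.1 tau)) (evc xy.2 tau)).
  by rewrite eqEsubset; split => [tau h xy _|tau h xy]; exact: (h xy).
- rewrite [X in closed X](_ : _ = \bigcap_(x in [set x : G | 0 <= x])
     [set tau : prod_topology (fun _ : G => R) | 0 <= tau x]).
    apply: closed_bigI => x _.
    apply: (@preimage_closed _ _
      (fun tau : prod_topology (fun _ : G => R) => tau x) [set r | 0 <= r]).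
      by move=> ? _; exact: evc.
    exact: closed_ge.
  by rewrite eqEsubset; split => tau h x x0; exact: (h x x0).
Qed.

Lemma trace_space_convex (x y : G -> R^o) (t : R) :
  trace_space u x -> trace_space u y -> 0 <= t <= 1 ->
  trace_space u ((1 - t) *: x + t *: y).
Proof.
move=> [[xB _ x0] x1] [[yB _ y0] y1] /andP[t0 t1].
have zE g : ((1 - t) *: x + t *: y) g = (1 - t) * x g + t * y g by [].
split; last by rewrite zE x1 y1; lra.
split.
- by move=> g h; rewrite !zE xB yB; ring.
- move=> /(congr1 (fun f => f u)) /eqP; rewrite zE x1 y1.
  by rewrite !mulr1 subrK oner_eq0.
- by move=> g g0; rewrite zE addr_ge0// mulr_ge0 ?x0 ?y0 ?subr_ge0.
Qed.

(** Every face containing [Z] meets the open segment from [x] to [y], so it contains the endpoint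
    [x]. *)
Lemma mem_smallest_face (Z : set (G -> R^o)) (x y : G -> R^o) (t : R) :
  trace_space u x -> trace_space u y -> 0 < t < 1 ->
  Z ((1 - t) *: x + t *: y) -> smallest_face u Z x.
Proof.
move=> Sx Sy t01 Zz F [[FS Fface] ZF].
apply: (Fface x y).
- move=> _ [s /= + <-]; rewrite in_itv/=; exact: trace_space_convex.
- exists ((1 - t) *: x + t *: y); split; last exact: ZF.
  by exists t => //=; rewrite in_itv.
- exists 0; first by rewrite /= in_itv/= lexx ler01.
  by rewrite subr0 scale1r scale0r addr0.
Qed.

End TraceSpace.

(** * Passage from row vectors back to the group *)

Theorem theorem5p2 (R : realType) (G : porderZmodType) (u : G)
    (H : zmodClosed G)
    (G_ordered : translation_invariant G)
    (u_unit : order_unit u)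
    (fin_dim : finite_dimensional (lin_span (@hat_subgroup R G u H)))
    (dense_values : forall tau : G -> R,
        (smallest_face u (annihilator u H) `\` annihilator u H) tau ->
        dense (tau @` [set` H])) :
  property_B R u H.
Proof.
have [n [b [Hb spanb]]] := finite_dimensional_span fin_dim.
have /choice[k /all_and2[Hk kE]] i : exists k, k \in H /\ hat k = b i.
  by have [k Hk kb] := Hb i; exists k.
pose p (tau : G -> R) : 'rV[R]_n := \row_i tau (k i).
have coords h : h \in H -> exists c, forall tau : G -> R,
    trace_space u tau -> dot c (p tau) = tau h.
  move=> Hh; have [|c cE] := spanb (hat h); first by exists h.
  exists c => tau Stau.
  have := congr1 (fun f : trace_space u -> R^o => f (exist _ tau (mem_set Stau))) cE.
  rewrite /hat /= => ->; rewrite dotE fct_sumE; apply: eq_bigr => i _.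
  by rewrite mxE -kE.
(* All vectors representing elements of [H] are kept, since the [k i] may be dependent on traces;
   this makes [A] a subgroup. *)
pose A : set 'rV[R]_n := [set c | exists2 h, h \in H &
  forall tau : G -> R, trace_space u tau -> dot c (p tau) = tau h].
have [N NP] := trace_bounded (R := R) G_ordered u_unit.
exists 2 => // h Hh eps eps0.
have [a0 a0E] := coords h Hh.
have [||||||| a [h' Hh' aE] aP] := @halving R (prod_topology (fun _ : G => R)) n
  (trace_space u) p (\sum_i (N (k i))%:R) A _ _ _ _ _ _ _ a0 eps eps0.
- exact: trace_space_compact.
- move=> i.
  have -> : (fun tau => p tau 0 i) =
      (fun tau : prod_topology (fun _ : G => R) => tau (k i)).
    by apply/funext => tau; rewrite mxE.
  exact: proj_continuous.
- move=> x y t Sx Sy t01; exists ((1 - t) *: (x : G -> R^o) + t *: (y : G -> R^o)).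
    exact: trace_space_convex.
  by apply/rowP => i; rewrite !mxE.
- move=> tau Stau; apply: ler_sum => i _; rewrite mxE; exact: NP.
- split; first exists 0; rewrite ?rpred0//.
    by move=> tau /trace_zmod/zmod_morphism0 ->; rewrite dot0l.
  move=> c c' [l Hl cE] [l' Hl' c'E]; exists (l - l'); first exact: rpredB.
  by move=> tau Stau; rewrite dotBl cE// c'E// (trace_zmod Stau).
- by move=> i; exists (k i) => // tau _; rewrite dot_delta mxE.
(* Normalizing the weights gives a trace between [x] and [y] that vanishes on [H], so [x] is in the
   face; [p x != 0] keeps [x] out of the annihilator. *)
- move=> x y s t Sx Sy s0 t0 xy x0 r e e0.
  have st0 : 0 < s + t by rewrite addr_gt0.
  have Zx : ~ annihilator u H x.
    move=> [_ xH]; move/eqP: x0; apply; apply/rowP => i; rewrite !mxE.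
    by have : [set 0] (x (k i)) by rewrite -xH; exists (k i) => //; exact: Hk.
  have Fx : smallest_face u (annihilator u H) x.
    have t01 : 0 < t / (s + t) < 1.
      by rewrite divr_gt0//= ltr_pdivrMr// mul1r ltrDr.
    apply: (mem_smallest_face Sx Sy t01).
    pose v := t / (s + t).
    pose z := (1 - v) *: (x : G -> R^o) + v *: (y : G -> R^o).
    have Sz : trace_space u z.
      by apply: trace_space_convex => //; case/andP: t01 => /ltW -> /ltW.
    have z0 l : l \in H -> z l = 0.
      move=> /coords[c cE].
      have -> : z l = (1 - v) * x l + v * y l by [].
      rewrite -!cE//.
      have -> : (1 - v) * dot c (p x) + v * dot c (p y)
          = (s + t)^-1 * dot c (s *: p x + t *: p y).
        by rewrite dotDr !dotZr /v; field; rewrite gt_eqF.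
      by rewrite xy dot0r mulr0.
    split => //; rewrite eqEsubset; split; first by move=> _ [l /= Hl <-]; exact: z0.
    by move=> _ ->; exists 0; [exact: rpred0|exact/z0/rpred0].
  have := dense_values x (conj Fx Zx) (ball r e).
  have bo : open (ball r e) by exact: ball_open.
  move=> /(_ (ex_intro _ r (ballxx _ e0)) bo)[v [rv [l Hl lE]]].
  have [c cE] := coords l Hl.
  exists c; first by exists l.
  by rewrite cE// lE; move: rv; rewrite -ball_normE.
exists h' => // tau Stau.
have := aP tau Stau.
by rewrite dotBl dotZl a0E// aE.
Qed.
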